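(* Let $\mathcal{D}$ be a distribution on $\mathbb{R}^d$, $f$ a linear threshold function on $\mathbb{R}^d$, $q\ge2$, $1\le k\le q-1$, and let $\mathcal{M}$ be a collection of $m$ bags sampled i.i.d. from $\mathrm{Ex}(f,\mathcal{D},q,k)$. There is an absolute constant $C_0\le1000$ such that for any $\delta,\varepsilon>0$, if $m\ge C_0d(\log q+\log(1/\delta))/\varepsilon^2$, then with probability at least $1-\delta$ over $\mathcal{M}$, every linear threshold function $h$ on $\mathbb{R}^d$ satisfies $\mathrm{BagErr}_{\mathrm{oracle}}(h,f,\mathcal{D},q,k)\le\mathrm{BagErr}_{\mathrm{sample}}(h,\mathcal{M})+\varepsilon$.
   Context: A linear threshold function is $\mathbf{x}\mapsto\mathrm{pos}(\mathbf{r}^{\mathsf T}\mathbf{x}+c)$, $\mathrm{pos}(a)=1$ if $a>0$ else $0$. The bag oracle $\mathrm{Ex}(f,\mathcal{D},q,k)$ returns a bag of $q$ independent points, $k$ drawn from $\mathcal{D}$ conditioned on $f=1$ and $q-k$ from $\mathcal{D}$ conditioned on $f=0$. $\mathrm{BagErr}_{\mathrm{oracle}}(h,f,\mathcal{D},q,k):=\Pr_{B\sim\mathrm{Ex}(f,\mathcal{D},q,k)}[\mathrm{Avg}\{h(\mathbf{x}):\mathbf{x}\in B\}\neq k/q]$ and $\mathrm{BagErr}_{\mathrm{sample}}(h,\mathcal{M}):=|\{B\in\mathcal{M}:\mathrm{Avg}\{h(\mathbf{x}):\mathbf{x}\in B\}\neq k/q\}|/m$. *)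

(* Defs.v *)
From HB Require Import structures.
From mathcomp Require Import all_boot all_order all_algebra.
From mathcomp Require Import all_classical all_reals all_analysis.
Set Implicit Arguments. Unset Strict Implicit. Unset Printing Implicit Defensive.
Import Order.TTheory GRing.Theory Num.Theory.
Local Open Scope classical_set_scope.
Local Open Scope ring_scope.

(* Points of R^d are d-tuples of reals, equipped with the product Borel
   sigma-algebra (the library's canonical measurable structure on tuples). *)

Definition pos (R : realType) (a : R) : bool := 0 < a.

Definition ltf (R : realType) (d : nat) (r : d.-tuple R) (c : R)
  (x : d.-tuple R) : bool :=
  pos (\sum_(i < d) tnth r i * tnth x i + c).

Definition cond_prob (R : realType) (d : nat)
  (D : probability (d.-tuple R) R) (S A : set (d.-tuple R)) : R :=
  fine (D (A `&` S)) / fine (D S).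

Definition level_set (R : realType) (d : nat) (f : d.-tuple R -> bool)
  (b : bool) : set (d.-tuple R) := [set x | f x = b].

(* The bag oracle Ex(f,D,q,k): positions j < k are drawn from D | f = 1,
   positions j >= k from D | f = 0, all independently.  The label of
   position j: *)
Definition bag_label (q k : nat) (j : 'I_q) : bool := (j < k)%N.

Definition bag_avg (R : realType) (d q : nat) (h : d.-tuple R -> bool)
  (B : 'I_q -> d.-tuple R) : R :=
  (\sum_(j < q) (h (B j) : nat)%:R) / q%:R.

(* A random bag Y on (Om, P) has law Ex(f,D,q,k): its q points are
   measurable and mutually independent with the prescribed conditional
   laws (product rule on all measurable rectangles). *)
Definition has_bag_law (R : realType) (d q k : nat)
  (D : probability (d.-tuple R) R) (f : d.-tuple R -> bool)
  (dO : measure_display) (Om : measurableType dO) (P : probability Om R)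
  (Y : 'I_q -> Om -> d.-tuple R) : Prop :=
  (forall j, measurable_fun setT (Y j)) /\
  forall A : 'I_q -> set (d.-tuple R), (forall j, measurable (A j)) ->
    P [set w | forall j, A j (Y j w)] =
    (\prod_(j < q) cond_prob D (level_set f (bag_label k j)) (A j))%:E.

(* m bags X i drawn i.i.d. from Ex(f,D,q,k): all m*q points are measurable
   and mutually independent, point (i,j) having law D | f = bag_label k j. *)
Definition iid_bags (R : realType) (d q k m : nat)
  (D : probability (d.-tuple R) R) (f : d.-tuple R -> bool)
  (dO : measure_display) (Om : measurableType dO) (P : probability Om R)
  (X : 'I_m -> 'I_q -> Om -> d.-tuple R) : Prop :=
  (forall i j, measurable_fun setT (X i j)) /\
  forall A : 'I_m -> 'I_q -> set (d.-tuple R),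
    (forall i j, measurable (A i j)) ->
    P [set w | forall i j, A i j (X i j w)] =
    (\prod_(i < m) \prod_(j < q)
       cond_prob D (level_set f (bag_label k j)) (A i j))%:E.

(* BagErr_oracle(h,f,D,q,k), computed through any bag Y with law Ex(f,D,q,k) *)
Definition bag_err_oracle (R : realType) (d q k : nat)
  (dO : measure_display) (Om : measurableType dO) (P : probability Om R)
  (Y : 'I_q -> Om -> d.-tuple R) (h : d.-tuple R -> bool) : \bar R :=
  P [set w | bag_avg h (fun j => Y j w) != k%:R / q%:R].

Definition bag_err_sample (R : realType) (d q k m : nat)
  (h : d.-tuple R -> bool) (M : 'I_m -> 'I_q -> d.-tuple R) : R :=
  #|[set i : 'I_m | bag_avg h (M i) != k%:R / q%:R]|%:R / m%:R.

(* Main.v *)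
Require Import Defs.
From HB Require Import structures.
From mathcomp Require Import all_boot all_order all_algebra.
From mathcomp Require Import all_classical all_reals all_analysis.
From mathcomp Require Import measurable_realfun ring lra.
Import Order.TTheory GRing.Theory Num.Theory.
Local Open Scope classical_set_scope.
Local Open Scope ring_scope.

Set Implicit Arguments.
Unset Strict Implicit.
Unset Printing Implicit Defensive.

(** The sample size contains no [log (1 / eps)], so a union bound over the
    patterns on the sample is not enough and the proof chains.

    A finite family of halfspaces splits [R^d] into finitely many cells, which
    turns the bags into independent samples from a finite type.  A ghost
    sample (Jensen) and random swaps bound the exponential moment of the
    largest deviation by that of a Rademacher process on [2m] bags.  That
    process is chained along nets of resolution [4^-j] in Hamming distance,
    the [j]-th link receiving the weight [2^-j].  A set of halfspaces whose bag
    errors are separated by a fraction [rho] stays separated on a random subsample of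
    about [2 ln N / rho] bags, so Sauer-Shelah and Radon bound its size:
    [ln N <= 2 (d + 1) ln (4 q / rho) + 1 / 2].  Altogether a deviation [eps]
    has probability at most [exp (2 (d + 1) ln (64 q) + 1 / 2 - eps^2 m / 32)].

    Rational halfspaces are countably many, so continuity of the probability
    extends this to all of them at once; every halfspace is a pointwise limit
    of rational ones, along which both errors pass to the limit. *)

(** * Sauer-Shelah lemma *)

Section Sauer.
Import mathcomp.boot.fintype mathcomp.boot.finset.
Variable T : finType.
Implicit Types (F : {set {set T}}) (S A B : {set T}).

Definition shatters F S : bool :=
  [forall B : {set T}, (B \subset S) ==> [exists A in F, A :&: S == B]].

Definition shattered_sets F : {set {set T}} := [set S | shatters F S]%SET.

Lemma shattersP F S :
  reflect (forall B, B \subset S -> exists2 A, A \in F & A :&: S = B)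
          (shatters F S).
Proof.
apply: (iffP forallP) => [h B sB|h B].
  by have /implyP/(_ sB)/existsP[A /andP[AF /eqP]] := h B; exists A.
apply/implyP => /h[A AF AB]; apply/existsP; exists A.
by rewrite AF AB eqxx.
Qed.

Lemma shatters_sub F F' S : F \subset F' -> shatters F S -> shatters F' S.
Proof.
move=> /subsetP sF /shattersP h; apply/shattersP => B /h[A AF AB].
by exists A => //; apply: sF.
Qed.

(* Pajor's form of the Sauer-Shelah lemma, by induction on the family: it is
   split according to membership of an element x, and a set S shattered by
   both halves accounts for the two sets S and x |: S. *)
Lemma card_le_shattered F : (#|F| <= #|shattered_sets F|)%N.
Proof.
move: {2}#|F| (leqnn #|F|) => n; elim: n F => [|n IH] F.
  by rewrite leqn0 => /eqP ->.
move=> leF; have [le1|gt1] := leqP #|F| 1%N.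
  have [->|[A AF]] := set_0Vmem F; first by rewrite cards0.
  apply: leq_trans le1 _; rewrite card_gt0; apply/set0Pn; exists finset.set0.
  rewrite inE; apply/shattersP => B; rewrite subset0 => /eqP ->.
  by exists A => //; rewrite setI0.
have [A [A' [AF A'F neqA]]] := card_gt1P gt1.
wlog [x xA xA'] : A A' AF A'F neqA / exists2 x, x \in A & x \notin A'.
  move=> wl; have [/subsetP sAA'|] := boolP (A \subset A'); last first.
    by move=> /subsetPn[x xA xA']; apply: (wl A A') => //; exists x.
  apply: (wl A' A) => //; first by rewrite eq_sym.
  apply/subsetPn; apply: contraNN neqA => sA'A.
  by rewrite eqEsubset sA'A andbT; apply/subsetP.
pose F1 := [set B in F | x \in B]%SET; pose F0 := [set B in F | x \notin B]%SET.
have cardF : #|F| = (#|F1| + #|F0|)%N.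
  rewrite -(cardsID [set B : {set T} | x \in B]%SET F); congr (_ + _)%N; apply: eq_card => B;
    by rewrite !inE // andbC.
(* Both halves are nonempty, hence strictly smaller than [F], so the induction hypothesis applies to
   each. *)
have F1_gt0 : (0 < #|F1|)%N by rewrite card_gt0; apply/set0Pn; exists A; rewrite !inE AF.
have F0_gt0 : (0 < #|F0|)%N by rewrite card_gt0; apply/set0Pn; exists A'; rewrite !inE A'F.
have le1 : (#|F1| <= #|shattered_sets F1|)%N.
  by apply: IH; rewrite -ltnS (leq_trans _ leF) // cardF -addn1 leq_add2l.
have le0 : (#|F0| <= #|shattered_sets F0|)%N.
  by apply: IH; rewrite -ltnS (leq_trans _ leF) // cardF -add1n leq_add2r.
have s1 : F1 \subset F by apply/subsetP => B; rewrite inE => /andP[].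
have s0 : F0 \subset F by apply/subsetP => B; rewrite inE => /andP[].
(* Every member of [F1] contains [x] and none of [F0] does, so a shattered set containing [x] would
   miss a trace: the empty set for [F1], the set itself for [F0]. *)
have x1 S : shatters F1 S -> x \notin S.
  move=> /shattersP/(_ finset.set0 (sub0set _))[B]; rewrite inE => /andP[_ xB] BS.
  by apply/negP => xS; have := in_set0 x; rewrite -BS inE xB xS.
have x0 S : shatters F0 S -> x \notin S.
  move=> /shattersP/(_ S (subxx _))[B]; rewrite inE => /andP[_ xB] BS.
  by apply/negP => xS; move: (xS); rewrite -{1}BS inE (negbTE xB).
pose I := shattered_sets F1 :&: shattered_sets F0.
pose J := [set x |: S | S in I].
have cardJ : #|J| = #|I|.
  rewrite card_in_imset // => S S' /setIP[]; rewrite inE => /x1 xS _ /setIP[].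
  rewrite inE => /x1 xS' _ /(congr1 (fun B => B :\ x)).
  by rewrite !setU1K.
have sub : (shattered_sets F1 :|: shattered_sets F0) :|: J \subset shattered_sets F.
  rewrite !subUset -andbA; apply/and3P; split.
  - by apply/subsetP => S; rewrite !inE; apply: shatters_sub.
  - by apply/subsetP => S; rewrite !inE; apply: shatters_sub.
  apply/subsetP => _ /imsetP[S /setIP[+ +] ->]; rewrite !inE => h1 h0.
  apply/shattersP => B sB.
  have xS := x1 _ h1.
  have sB' : B :\ x \subset S by rewrite subDset.
  have [xB|xB] := boolP (x \in B).
    have /shattersP/(_ _ sB')[C CF1 CS] := h1; exists C.
      by apply: (subsetP s1).
    move: CF1; rewrite inE => /andP[_ xC].
    by rewrite setIUr CS (setIidPr _) ?sub1set// setD1K.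
  have /shattersP/(_ _ sB')[C CF0 CS] := h0; exists C.
    by apply: (subsetP s0).
  move: CF0; rewrite inE => /andP[_ xC].
  rewrite setIUr CS (_ : C :&: [set x]%SET = finset.set0) ?set0U.
    by apply/setP => y; rewrite !inE; case: eqP => // ->; rewrite (negbTE xB).
  by apply/setP => y; rewrite !inE; case: eqP => [->|]; rewrite ?andbF// (negbTE xC).
(* Members of [J] contain [x], so [J] is disjoint from the union, and its [#|I|] elements restore
   what the union counts only once. *)
apply: leq_trans (subset_leq_card sub).
rewrite cardsU (_ : _ :&: J = finset.set0) ?cards0 ?subn0.
  rewrite cardJ cardsU subnK; last first.
    by rewrite (leq_trans (subset_leq_card (subsetIl _ _))) ?leq_addr.
  by rewrite cardF leq_add.
apply/setP => S; rewrite !inE; apply/negP => /andP[+ /imsetP[S' _ SE]].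
have xS : x \in S by rewrite SE setU11.
by case/orP => [/x1|/x0]; rewrite xS.
Qed.

Lemma sum_expr_card (R : comNzRingType) (x : R) :
  \sum_(S : {set T}) x ^+ #|S| = (1 + x) ^+ #|T|.
Proof.
rewrite addrC -prodr_const bigA_distr /=.
under [RHS]eq_bigr do rewrite -big_mkcondr/= .
by apply: eq_bigr => S _; rewrite big_const iter_mulr_1.
Qed.

(** The shattered sets, at least [#|F|] many, each contribute at least [x ^+ D] to the sum of all
    [x ^+ #|S|], which is [(1 + x) ^+ #|T|]. Leaving [x] free avoids binomial sums. *)
Lemma card_vc_le (R : realType) F D (x : R) : 0 < x -> x <= 1 ->
  (forall S, shatters F S -> (#|S| <= D)%N) ->
  #|F|%:R * x ^+ D <= expR (x * #|T|%:R).
Proof.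
move=> x0 x1 vc.
apply: (@le_trans _ _ ((1 + x) ^+ #|T|)); last first.
  rewrite mulrC expRM_natl lerXn2r ?nnegrE ?expR_ge0 ?addr_ge0 ?(ltW x0)//.
  exact: expR_ge1Dx.
rewrite -sum_expr_card.
apply: (@le_trans _ _ (\sum_(S in shattered_sets F) x ^+ D)).
  rewrite sumr_const -[leRHS]mulr_natl; apply: ler_wpM2r.
    by rewrite exprn_ge0 ?ltW.
  by rewrite ler_nat card_le_shattered.
rewrite big_mkcond; apply: ler_sum => S _; case: ifPn => [|_].
  by rewrite inE => /vc h; rewrite ler_wiXn2l// ltW.
by rewrite exprn_ge0// ltW.
Qed.
End Sauer.

(** * Halfspaces and packing numbers *)

Section HalfspaceGrowth.
Import mathcomp.boot.fintype mathcomp.boot.finset.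

(* Radon's argument: more than d + 1 points of R^d admit a nontrivial affine
   dependence, and no affine function has the sign pattern of its coefficients. *)
Lemma shatters_ltf (R : realType) (d : nat) (T G : finType) (z : T -> d.-tuple R)
    (r : G -> d.-tuple R) (c : G -> R) (S : {set T}) :
  shatters [set [set t | ltf (r g) (c g) (z t)] | g : G] S ->
  (#|S| <= d.+1)%N.
Proof.
move=> /shattersP sh; rewrite leqNgt; apply/negP => ltS.
(* The column [ord_max] is constantly 1, so a vector in the left kernel is an affine dependence. *)
pose M := \matrix_(i < #|S|, j < d.+1)
  (if unlift ord_max j is Some j' then tnth (z (enum_val i)) j' else 1 : R).
have kerM : kermx M != 0.
  by rewrite -mxrank_eq0 mxrank_ker subn_eq0 -ltnNge (leq_ltn_trans (rank_leq_col _)).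
have [v vM v0] := rowV0Pn kerM.
have {vM v0} [u uM [i0 ui0]] : exists2 u : 'rV_#|S|, u *m M = 0 & exists i, 0 < u 0 i.
  have /sub_kermxP vM0 := vM.
  have [i vi] : exists i, v 0 i != 0.
    apply/existsP; apply: contraNT v0; rewrite negb_exists => /forallP h.
    by apply/eqP/rowP => i; rewrite mxE; apply/eqP; have := h i; rewrite negbK.
  have [vi0|vi0|/eqP] := ltgtP (v 0 i) 0; last by rewrite (negbTE vi).
    by exists (- v); [rewrite mulNmx vM0 oppr0|exists i; rewrite mxE oppr_gt0].
  by exists v => //; exists i.
pose B := [set enum_val i | i : 'I_#|S| & 0 < u 0 i].
have [|A /imsetP[g _ ->] AB] := sh B.
  by apply/subsetP => _ /imsetP[i _ ->]; apply: enum_valP.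
pose a (i : 'I_#|S|) := \sum_(j < d) tnth (r g) j * tnth (z (enum_val i)) j + c g.
have aP i : (0 < a i) = (0 < u 0 i).
  have /setP/(_ (enum_val i)) := AB; rewrite inE enum_valP andbT inE.
  rewrite /ltf /pos => ->; apply/imsetP/idP => [[j + /enum_val_inj->]|ui].
    by rewrite inE.
  by exists i; rewrite ?inE.
have ua0 : \sum_i u 0 i * a i = 0.
  have col j : \sum_i u 0 i * M i j = 0 by have := congr1 (fun N : 'rV_d.+1 => N 0 j) uM; rewrite !mxE.
  under eq_bigr do rewrite /a mulrDr mulr_sumr.
  rewrite big_split /= exchange_big /=.
  rewrite big1 ?add0r => [|j _].
    rewrite -mulr_suml; have := col ord_max.
    under eq_bigr do rewrite mxE unlift_none mulr1.
    by move=> ->; rewrite mul0r.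
  under eq_bigr do rewrite mulrCA.
  rewrite -mulr_sumr; have := col (lift ord_max j).
  under eq_bigr do rewrite mxE liftK.
  by move=> ->; rewrite mulr0.
have ge0 i : 0 <= u 0 i * a i.
  have [ui|ui] := ltP 0 (u 0 i); first by rewrite mulr_ge0 ?ltW// aP.
  by rewrite mulr_le0// leNgt aP -leNgt.
have /eqP := psumr_eq0P (fun i _ => ge0 i) ua0 (i := i0) isT.
by rewrite mulf_eq0 !gt_eqF// aP.
Qed.
End HalfspaceGrowth.

Section Packing.
Import mathcomp.boot.fintype mathcomp.boot.finset.
Variables (R : realType) (G I : finType) (b : G -> I -> bool).

Definition hamming (g h : G) : nat := #|[pred i | b g i != b h i]|.

Lemma hamming_sym g h : hamming g h = hamming h g.
Proof. by apply: eq_card => i; rewrite !inE eq_sym. Qed.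

Lemma hammingxx g : hamming g g = 0%N.
Proof. by apply: eq_card0 => i; rewrite !inE eqxx. Qed.

Lemma hamming_eq0 g h : hamming g h = 0%N -> b g =1 b h.
Proof.
move=> /card0_eq h0 i; have := h0 i.
by rewrite !inE => /negbFE/eqP.
Qed.

Definition trace (k : nat) (s : {ffun 'I_k -> I}) (g : G) : {ffun 'I_k -> bool} :=
  [ffun j => b g (s j)].

Lemma card_same_trace k g h :
  #|[pred s : {ffun 'I_k -> I} | trace s g == trace s h]| = ((#|I| - hamming g h) ^ k)%N.
Proof.
rewrite (_ : (#|I| - _)%N = #|[pred i | b g i == b h i]|); last first.
  rewrite -(cardC [pred i | b g i != b h i]) addKn.
  by apply: eq_card => i; rewrite !inE negbK.
transitivity #|ffun_on_mem 'I_k (mem [pred i | b g i == b h i])|; last first.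
  by rewrite card_ffun_on card_ord.
apply: eq_card => s.
rewrite !inE; apply/eqP/ffun_onP => [/ffunP e j|e].
  by have := e j; rewrite !ffunE inE => ->.
by apply/ffunP => j; rewrite !ffunE; apply/eqP; have := e j; rewrite inE.
Qed.

(* Sampling k indices at random: each pair is left unseparated with probability
   at most (1 - rho)^k, and a union bound is made over the pairs. *)
Lemma separating_sample (A : {set G}) (rho : R) (k : nat) :
  (0 < #|I|)%N -> rho <= 1 ->
  (forall g h, g \in A -> h \in A -> g != h ->
     rho * #|I|%:R <= (hamming g h)%:R) ->
  #|A|%:R ^+ 2 * (1 - rho) ^+ k < 1 ->
  exists s : {ffun 'I_k -> I}, {in A &, injective (trace s)}.
Proof.
move=> I0 rho1 sep small; apply: contrapT => /forallNP noinj.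
pose P := [pred p : G * G | [&& p.1 \in A, p.2 \in A & p.1 != p.2]].
(* Without an injective sample, every sample confuses some ordered pair of distinct members of [A];
   double counting then contradicts [small]. *)
have le1 : (#|{ffun 'I_k -> I}| <=
    \sum_(s : {ffun 'I_k -> I}) \sum_(p | P p) (trace s p.1 == trace s p.2))%N.
  rewrite -sum1_card; apply: leq_sum => s _.
  have [p Pp e] : exists2 p, P p & trace s p.1 = trace s p.2.
    apply: contrapT => h; apply: (noinj s) => g g' gA g'A e.
    apply/eqP; apply: contraT => ne; case: h; exists (g, g') => //=.
    by rewrite gA g'A.
  by rewrite (bigD1 p)//= e eqxx.
move: le1; rewrite exchange_big /= -(ler_nat R); apply/negP; rewrite -ltNge.
rewrite natr_sum.
apply: (@le_lt_trans _ _ (\sum_(p | P p) ((1 - rho) ^+ k * #|I|%:R ^+ k))).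
  apply: ler_sum => -[g h] /and3P[/= gA hA ne].
  rewrite -big_mkcond /= sum1_card card_same_trace natrX -exprMn.
  apply: lerXn2r; rewrite ?nnegrE ?mulr_ge0 ?subr_ge0//.
  have le : (hamming g h <= #|I|)%N by apply: max_card.
  by rewrite natrB// mulrBl mul1r lerB// sep.
rewrite sumr_const -[ltLHS]mulr_natl card_ffun card_ord natrX mulrA.
rewrite gtr_pMl ?exprn_gt0 ?ltr0n//; apply: le_lt_trans small.
rewrite ler_wpM2r ?exprn_ge0 ?subr_ge0//.
rewrite -natrX ler_nat expnS expn1 -cardsX; apply: subset_leq_card.
by apply/subsetP => -[g h]; rewrite !inE /= => /and3P[-> ->].
Qed.

Variables (D q : nat).
Hypothesis q_gt0 : (0 < q)%N.
(** An index stands for a bag, so [k] indices involve [k * q] points; this is the Sauer-Shelah bound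
    for them, in the form of [card_vc_le]. *)
Hypothesis growth : forall k (s : {ffun 'I_k -> I}) (x : R), 0 < x -> x <= 1 ->
  #|[set trace s g | g : G]|%:R * x ^+ D <= expR (x * (k * q)%:R).

(** With [l = ln #|A|], some sample of just over [2 l / rho] indices separates [A], so [#|A|] is at
    most the number of traces on it, which [growth] controls. The choice [x = rho / (4 q)] makes the
    exponent at most [l / 2 + 1 / 4], and [l / 2] is absorbed on the left. *)
Lemma packing_bound (A : {set G}) (rho : R) : 0 < rho -> rho <= 1 ->
  (forall g h, g \in A -> h \in A -> g != h ->
     rho * #|I|%:R < (hamming g h)%:R) ->
  #|A|%:R <= expR (2 * D%:R * ln (4 * q%:R / rho) + 1 / 2).
Proof.
move=> rho0 rho1 sep.
have q1 : 1 <= q%:R :> R by rewrite ler1n.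
have ln0 : 0 <= ln (4 * q%:R / rho).
  by apply: ln_ge0; rewrite ler_pdivlMr// mul1r; lra.
have [A1|A2] := leqP #|A| 1%N.
  apply: (@le_trans _ _ 1); first by rewrite (ler_nat _ _ 1).
  by rewrite -[leLHS]expR0 ler_expR addr_ge0 ?divr_ge0 ?mulr_ge0.
have [g [h [gA hA ne]]] := card_gt1P A2.
have I0 : (0 < #|I|)%N.
  rewrite lt0n; apply/eqP => I0; have := sep g h gA hA ne.
  by rewrite I0 mulr0 ltr0n => /card_gt0P[i _]; have := card0_eq I0 i; rewrite inE.
have N0 : 0 < #|A|%:R :> R by rewrite ltr0n (ltn_trans _ A2).
pose l := ln #|A|%:R : R.
have Nl : #|A|%:R = expR l by rewrite lnK.
have l0 : 0 <= l by apply: ln_ge0; rewrite ler1n (ltn_trans _ A2).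
pose k := (Num.truncn (2 * l / rho)).+1.
have kge : 2 * l / rho < k%:R by apply: truncnS_gt.
have kle : k%:R <= 2 * l / rho + 1.
  by rewrite -[leLHS]natr1 lerD2r truncn_le// divr_ge0 ?mulr_ge0// ltW.
have [|g' h' g'A h'A ne'||s inj] := @separating_sample A rho k _ rho1.
- by [].
- by apply/ltW/sep.
- rewrite Nl expr2 -expRD.
  apply: (@le_lt_trans _ _ (expR (l + l) * expR (- rho * k%:R))).
    rewrite ler_pM2l ?expR_gt0// mulrC expRM_natl lerXn2r ?nnegrE ?expR_ge0 ?subr_ge0//.
    exact: expR_ge1Dx.
  by rewrite -expRD expR_lt1; move: kge; rewrite ltr_pdivrMr//; lra.
have x0 : 0 < rho / (4 * q%:R) by rewrite divr_gt0// mulr_gt0//; lra.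
have x1 : rho / (4 * q%:R) <= 1 by rewrite ler_pdivrMr; lra.
have := growth s x0 x1; set N' := #|_|%:R; set x := rho / _ in x0 x1 *.
have leN : #|A|%:R <= N'.
  rewrite ler_nat -(card_in_imset inj) subset_leq_card//; apply/subsetP => _ /imsetP[a _ ->].
  exact: imset_f.
move=> gr; have {}gr : expR l * x ^+ D <= expR (x * (k * q)%:R).
  by rewrite -Nl; apply: le_trans gr; rewrite ler_wpM2r// exprn_ge0// ltW.
have lnx : ln (4 * q%:R / rho) = - ln x.
  by rewrite -lnV ?posrE// /x invf_div.
move: gr; rewrite -{1}(lnK x0) -expRM_natl -expRD ler_expR => gr.
rewrite Nl ler_expR lnx.
have : x * (k * q)%:R <= l / 2 + 1 / 4.
  rewrite natrM /x (_ : _ / _ * _ = rho * k%:R / 4); last by field; rewrite gt_eqF//; lra.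
  have : rho * k%:R <= 2 * l + rho.
    by rewrite -(@ler_pdivlMl _ rho)// mulrDr mulVf ?gt_eqF// mulrC.
  lra.
nra.
Qed.
End Packing.

(** * Exponential inequalities *)

Section Cosh.
Import numFieldNormedType.Exports.

Lemma is_derive_expRN (R : realType) (y : R) :
  is_derive y 1 (fun z : R => expR (- z)) (- expR (- y)).
Proof.
have h := is_derive1_comp (is_derive_expR (- y)) (is_deriveN (is_derive_id y 1)).
by apply: is_derive_eq; rewrite mulrN1.
Qed.

Lemma ge0_sinh_le_xcosh (R : realType) (x : R) : 0 <= x ->
  expR x - expR (- x) <= x * (expR x + expR (- x)).
Proof.
move=> x0; pose f (y : R) := y * (expR y + expR (- y)) - (expR y - expR (- y)).
have dN := @is_derive_expRN R.
have df (y : R) : is_derive y 1 f (y * (expR y - expR (- y))).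
  by apply: is_derive_eq; rewrite /GRing.scale /=; ring.
have : f 0 <= f x.
  apply: (@ger0_derive1_ndecry R f 0) => // [y|].
  - rewrite in_itv /= andbT derive1E => y0; rewrite derive_val.
    by rewrite mulr_ge0 ?(ltW y0)// subr_ge0 ler_expR; lra.
  - apply: continuous_subspaceT => y; apply: differentiable_continuous.
    by apply/derivable1_diffP; exact: ex_derive.
by rewrite /f mul0r oppr0 !subrr subr_ge0.
Qed.

(** After reduction to [x >= 0], the quotient of the two sides is nonincreasing, by
    [ge0_sinh_le_xcosh]; [f] is minus twice this quotient. *)
Lemma cosh_le (R : realType) (x : R) :
  expR x + expR (- x) <= 2 * expR (x ^+ 2 / 2).
Proof.
wlog x0 : x / 0 <= x.
  move=> wl; have [/wl//|/ltW xN] := leP 0 x.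
  by have := wl (- x); rewrite oppr_ge0 opprK sqrrN addrC => /(_ xN).
pose f (y : R) := - (expR (- (y ^+ 2 / 2)) * (expR y + expR (- y))).
have dN := @is_derive_expRN R.
have dX (y : R) : is_derive y 1 (fun z : R => - (z ^+ 2 / 2)) (- y).
  by apply: is_derive_eq; rewrite /GRing.scale /=; field.
have dG (y : R) : is_derive y 1 (fun z : R => expR (- (z ^+ 2 / 2))) (- y * expR (- (y ^+ 2 / 2))).
  have h := @is_derive1_comp R expR (fun z : R => - (z ^+ 2 / 2)) y _ _ (is_derive_expR _) (dX y).
  by apply: is_derive_eq; rewrite mulrC.
have df (y : R) : is_derive y 1 f (expR (- (y ^+ 2 / 2)) * (y * (expR y + expR (- y)) - (expR y - expR (- y)))).
  by apply: is_derive_eq; rewrite /GRing.scale /=; ring.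
have : f 0 <= f x.
  apply: (@ger0_derive1_ndecry R f 0) => // [y|].
  - rewrite in_itv /= andbT derive1E => y0; rewrite derive_val.
    by rewrite mulr_ge0 ?expR_ge0// subr_ge0 ge0_sinh_le_xcosh ?ltW.
  - apply: continuous_subspaceT => y; apply: differentiable_continuous.
    by apply/derivable1_diffP; exact: ex_derive.
rewrite /f expr0n /= mul0r oppr0 expR0 mul1r lerN2 expRN mulrC.
by rewrite ler_pdivrMr ?expR_gt0.
Qed.

End Cosh.

(** Jensen's inequality for weights of total mass at most 1: the missing mass sits at 0, where the
    exponential is 1. It follows from the tangent line at [Y]. *)
Lemma expR_convex_comb (R : realType) (I : Type) (s : seq I) (P : pred I) (a y : I -> R) :
  (forall i, P i -> 0 <= a i) -> \sum_(i <- s | P i) a i <= 1 ->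
  expR (\sum_(i <- s | P i) a i * y i) <=
  \sum_(i <- s | P i) a i * expR (y i) + (1 - \sum_(i <- s | P i) a i).
Proof.
move=> a0 a1; set A := \sum_(i <- s | P i) a i in a1 *; set Y := \sum_(i <- s | P i) a i * y i.
have tan (z : R) : expR Y * (1 + z - Y) <= expR z.
  have -> : expR z = expR Y * expR (z - Y) by rewrite -expRD; congr expR; ring.
  by rewrite ler_pM2l ?expR_gt0// -addrA expR_ge1Dx.
have : \sum_(i <- s | P i) a i * (expR Y * (1 + y i - Y)) <=
       \sum_(i <- s | P i) a i * expR (y i).
  by apply: ler_sum => i Pi; rewrite ler_wpM2l ?a0.
rewrite (_ : \sum_(i <- s | P i) _ = expR Y * (A * (1 - Y) + Y)); last first.
  rewrite mulrDr mulr_sumr mulr_suml mulr_sumr -big_split /=.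
  by apply: eq_bigr => i _; ring.
have := tan 0; rewrite expR0 => t0.
have : (1 - A) * (expR Y * (1 + 0 - Y)) <= (1 - A) * 1 by rewrite ler_wpM2l// subr_ge0.
lra.
Qed.

(** * Chaining *)

(** The sum over sign vectors factors into one hyperbolic cosine per coordinate, bounded by
    [cosh_le]. *)
Lemma rademacher_mgf (R : realType) (m : nat) (v : 'I_m -> R) :
  \sum_(s : {ffun 'I_m -> bool}) expR (\sum_i (-1) ^+ s i * v i) <=
  2 ^+ m * expR ((\sum_i v i ^+ 2) / 2).
Proof.
under eq_bigr do rewrite expR_sum.
rewrite -(bigA_distr_bigA (fun i b => expR ((-1) ^+ (b : bool) * v i))) /=.
rewrite mulr_suml expR_sum -[m in X in _ <= X * _]card_ord -prodr_const -big_split /=.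
apply: ler_prod => i _; rewrite big_bool /= addr_ge0 ?expR_ge0//=.
by rewrite expr1 expr0 mulN1r mul1r addrC cosh_le.
Qed.

Section Chaining.
Import mathcomp.boot.fintype mathcomp.boot.finset.

Lemma sum_half_le1 (R : realType) (n : nat) :
  \sum_(i < n) (2^-1 : R) ^+ i.+1 <= 1.
Proof.
rewrite (_ : \sum_(i < n) _ = 1 - 2^-1 ^+ n); first by rewrite gerBl exprn_ge0.
elim: n => [|n IH]; first by rewrite big_ord0 expr0 subrr.
by rewrite big_ord_recr /= IH exprS; field.
Qed.

(** A maximal [r]-separated set is also a net: a point farther than [r] from all its members could
    be added to it. *)
Lemma maximal_separated_set (R : realType) (G : finType) (H : G -> G -> nat) (r : R) :
  0 <= r -> (forall g, H g g = 0%N) -> (forall g h, H g h = H h g) ->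
  exists A : {set G},
    (forall g h, g \in A -> h \in A -> g != h -> r < (H g h)%:R) /\
    (forall g, exists2 h, h \in A & (H g h)%:R <= r).
Proof.
move=> r0 H0 Hs.
pose sep (A : {set G}) := [forall g in A, forall h in A, (g != h) ==> (r < (H g h)%:R)].
have sepP (A : {set G}) : reflect (forall g h, g \in A -> h \in A -> g != h -> r < (H g h)%:R) (sep A).
  apply: (iffP forall_inP) => [h g g' gA g'A|h g gA].
    by apply/implyP; have /forall_inP/(_ g' g'A) := h g gA.
  by apply/forall_inP => g' g'A; apply/implyP; apply: h.
have sep0 : sep finset.set0 by apply/sepP => g h; rewrite inE.
have [A /maxsetP[/sepP sA maxA] _] := maxset_exists sep0.
exists A; split=> // g; apply: contrapT => far.
have {}far h : h \in A -> r < (H g h)%:R.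
  by move=> hA; rewrite ltNge; apply/negP => le; apply: far; exists h.
have gA : g \notin A by apply/negP => /far; rewrite H0 ltNge r0.
have /maxA/(_ (subsetUr _ _)) AE : sep (g |: A).
  apply/sepP => h h' /setU1P[->|hA] /setU1P[->|h'A] ne.
  - by rewrite eqxx in ne.
  - exact: far.
  - by rewrite Hs far.
  - exact: sA.
by rewrite -AE setU11 in gA.
Qed.

(* Telescoping each S g along its projections onto nets of resolution n / 4^j,
   starting from the zero process, and distributing the links with weights 2^-j. *)
Lemma chaining (R : realType) (Om G : finType) (S : G -> Om -> R)
    (H : G -> G -> nat) (n J : nat) (L : nat -> R) (lam : R) :
  (forall g, H g g = 0%N) -> (forall g h, H g h = H h g) ->
  (forall g h, H g h = 0%N -> S g =1 S h) ->
  (forall t g, \sum_s expR (t * S g s) <= #|Om|%:R * expR (t ^+ 2 * n%:R)) ->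
  (forall t g h, \sum_s expR (t * (S g s - S h s)) <=
                 #|Om|%:R * expR (t ^+ 2 * (H g h)%:R)) ->
  (forall j (A : {set G}),
     (forall g h, g \in A -> h \in A -> g != h -> (n%:R / 4 ^+ j.+1 : R) < (H g h)%:R) ->
     #|A|%:R <= expR (L j)) ->
  (n < 4 ^ J.+1)%N ->
  \sum_s \big[Num.max/0]_g expR (lam * S g s) <=
  #|Om|%:R * expR (4 * lam ^+ 2 * n%:R + \sum_(i < J.+1) 2^-1 ^+ i.+1 * L i).
Proof.
move=> H0 Hs HS mgf0 mgf pack nJ.
have [g0 _|noG] := pickP (@predT G); last first.
  apply: (@le_trans _ _ 0); last by rewrite mulr_ge0 ?expR_ge0.
  by apply: sumr_le0 => s _; apply/bigmax_leP; split=> // g; have := noG g.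
pose r j : R := n%:R / 4 ^+ j.+1.
have r_ge0 j : 0 <= r j by rewrite divr_ge0.
have /choice[net netP] := fun j => maximal_separated_set (r_ge0 j) H0 Hs.
have /choice[p pP] : forall j, exists p : G -> G, forall g, p g \in net j /\ (H g (p g))%:R <= r j.
  move=> j; have [_ net_j] := netP j.
  have /choice[p pP] : forall g, exists h, h \in net j /\ (H g h)%:R <= r j.
    by move=> g; have [h] := net_j g; exists h.
  by exists p.
(* Level 0 is linked to the zero process, level [j + 1] to the projection of [h] onto the net of
   level [j]. *)
pose base j h s := if j is i.+1 then S (p i h) s else 0.
pose a j : R := 2^-1 ^+ j.+1.
have a0 j : 0 < a j by rewrite exprn_gt0.
(* A soft maximum over the links of level [j]; the discount [L j] pays for the size of the net, so
   that the sum of [Q j] over [s] has a bound free of [j]. *)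
pose Q j s := \sum_(h in net j) expR ((lam / a j) * (S h s - base j h s) - L j).
have Qge j s h : h \in net j -> expR ((lam / a j) * (S h s - base j h s) - L j) <= Q j s.
  move=> hN; rewrite /Q (bigD1 h)//= lerDl; apply: sumr_ge0 => ? _; exact: expR_ge0.
have Qgt0 j s : 0 < Q j s.
  by apply: lt_le_trans (Qge j s (p j g0) _); [exact: expR_gt0|have [] := pP j g0].
have link j h s : h \in net j ->
    lam * (S h s - base j h s) <= a j * (ln (Q j s) + L j).
  move=> hN; have := Qge _ s _ hN; rewrite -{1}(lnK (Qgt0 j s)) ler_expR lerBlDr.
  by rewrite mulrAC ler_pdivrMr// [_ * a j]mulrC.
have chain s : forall j g, g \in net j ->
    lam * S g s <= \sum_(i < j.+1) a i * (ln (Q i s) + L i).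
  elim=> [|j IH] g gN.
    by rewrite big_ord1; have := link _ _ s gN; rewrite /base subr0.
  rewrite big_ord_recr /=; have := link _ _ s gN; rewrite /base.
  have := IH (p j g) _; have [pN _] := pP j g.
  by move=> /(_ pN); rewrite mulrBr; lra.
pose A := \sum_(i < J.+1) a i * L i.
have asum : \sum_(i < J.+1) a i <= 1 by exact: sum_half_le1.
have pt s : \big[Num.max/0]_g expR (lam * S g s) <=
    (\sum_(i < J.+1) a i * Q i s + (1 - \sum_(i < J.+1) a i)) * expR A.
  have rhs : expR (\sum_(i < J.+1) a i * ln (Q i s)) <= \sum_(i < J.+1) a i * Q i s + (1 - \sum_(i < J.+1) a i).
    apply: le_trans (expR_convex_comb _ _ asum) _ => [i _|]; first exact: ltW.
    by under eq_bigr do rewrite lnK ?posrE ?Qgt0//.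
  have rhs0 := le_trans (expR_ge0 _) rhs.
  apply/bigmax_leP; split=> [|g _]; first by rewrite mulr_ge0// expR_ge0.
  have [pN Hle] := pP J g.
  (* As [n < 4 ^ J.+1], the last resolution is below 1, so [g] is at distance 0 from its
     projection. *)
  have /HS Sp : H g (p J g) = 0%N.
    apply/eqP; rewrite -leqn0 -ltnS -(ltr_nat R); apply: le_lt_trans Hle _.
    by rewrite /r ltr_pdivrMr ?exprn_gt0// mul1r -natrX ltr_nat.
  apply: (@le_trans _ _ (expR (\sum_(i < J.+1) a i * ln (Q i s)) * expR A)); last first.
    by rewrite ler_wpM2r ?expR_ge0.
  rewrite -expRD ler_expR Sp /A -big_split /=.
  under eq_bigr do rewrite -mulrDr.
  exact: chain.
apply: (le_trans (ler_sum _ (fun s _ => pt s))).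
rewrite -mulr_suml expRD mulrA -/A; apply: ler_wpM2r; first exact: expR_ge0.
(* Dividing by the weight turns [lam ^+ 2] into [lam ^+ 2 * 4 ^+ j.+1]; the variance proxy of a
   link, at most [n / 4 ^+ j], cancels this up to the factor 4. *)
have sumQ j : \sum_s Q j s <= #|Om|%:R * expR (4 * lam ^+ 2 * n%:R).
  rewrite /Q exchange_big /=.
  apply: (@le_trans _ _ (\sum_(h in net j) #|Om|%:R * expR (4 * lam ^+ 2 * n%:R) * expR (- L j))).
    apply: ler_sum => h hN; under eq_bigr do rewrite expRD.
    rewrite -mulr_suml ler_wpM2r ?expR_ge0//.
    have lama : (lam / a j) ^+ 2 = lam ^+ 2 * 4 ^+ j.+1.
      have -> : 4 = 2 ^+ 2 :> R by rewrite -natrX.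
      by rewrite /a exprVn invrK exprMn exprAC.
    case: j hN lama => [|j] hN lama.
      rewrite /base; under eq_bigr do rewrite subr0.
      by apply: le_trans (mgf0 _ _) _; rewrite lama expr1 [_ * 4]mulrC.
    rewrite /base; apply: le_trans (mgf _ _ _) _.
    rewrite ler_wpM2l// ler_expR lama.
    have [_ le] := pP j h.
    apply: (@le_trans _ _ (lam ^+ 2 * 4 ^+ j.+2 * r j)).
      by rewrite ler_wpM2l// mulr_ge0 ?sqr_ge0 ?exprn_ge0.
    rewrite /r [4 ^+ j.+2]exprS (_ : _ * _ = 4 * lam ^+ 2 * n%:R) //.
    by field; rewrite expf_neq0// pnatr_eq0.
  rewrite sumr_const -[leLHS]mulr_natl mulrCA ler_piMr ?mulr_ge0 ?expR_ge0//.
  rewrite expRN ler_pdivrMr ?expR_gt0// mul1r pack//.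
  by have [] := netP j.
rewrite big_split /= sumr_const exchange_big /=.
set E := expR _ in sumQ *.
have E1 : 1 <= E.
  rewrite -[leLHS]expR0 ler_expR; apply: mulr_ge0 => //; apply: mulr_ge0 => //.
  exact: sqr_ge0.
(* The mass missing from the weights is charged the same bound, since [E >= 1]. *)
apply: (@le_trans _ _ (\sum_(i < J.+1) a i * (#|Om|%:R * E) + (1 - \sum_(i < J.+1) a i) * (#|Om|%:R * E))).
  apply: lerD.
    by apply: ler_sum => i _; rewrite -mulr_sumr; apply: ler_wpM2l; rewrite ?(ltW (a0 i)).
  by rewrite -[leLHS]mulr_natr; apply: ler_wpM2l; rewrite ?subr_ge0// ler_peMr.
by rewrite -mulr_suml -mulrDl addrCA subrr addr0 mul1r.
Qed.
End Chaining.

(** * Symmetrization *)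

Lemma sum_half_linear_le2 (R : realType) (n : nat) :
  \sum_(i < n) (2^-1 : R) ^+ i.+1 * i.+1%:R <= 2.
Proof.
rewrite (_ : \sum_(i < n) _ = 2 - (n%:R + 2) * 2^-1 ^+ n); last first.
  elim: n => [|n IH]; first by rewrite big_ord0 expr0; ring.
  by rewrite big_ord_recr /= IH -[n.+1%:R]natr1 exprS; field.
by rewrite gerBl mulr_ge0 ?addr_ge0 ?exprn_ge0.
Qed.

(** The [i]-th logarithm is [ln (4 q) + (i + 1) ln 4]; against the weights these sum to at most
    [ln (4 q) + 2 ln 4 = ln (64 q)]. *)
Lemma log_covering_sum_le (R : realType) (D q n : nat) : (0 < q)%N ->
  \sum_(i < n) (2^-1 : R) ^+ i.+1 * (2 * D%:R * ln (4 * q%:R / (4 ^+ i.+1)^-1) + 1 / 2) <=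
  2 * D%:R * ln (64 * q%:R) + 1 / 2.
Proof.
move=> q0; have q0' : 0 < q%:R :> R by rewrite ltr0n.
have lnE (i : nat) : ln (4 * q%:R / (4 ^+ i.+1)^-1) = ln (4 * q%:R) + i.+1%:R * ln 4 :> R.
  rewrite invrK [LHS]lnM ?posrE ?mulr_gt0 ?exprn_gt0//; congr (_ + _).
  by rewrite lnXn// mulr_natl.
under eq_bigr do rewrite lnE.
have -> : \sum_(i < n) (2^-1 : R) ^+ i.+1 * (2 * D%:R * (ln (4 * q%:R) + i.+1%:R * ln 4) + 1 / 2) =
    (2 * D%:R * ln (4 * q%:R) + 1 / 2) * (\sum_(i < n) 2^-1 ^+ i.+1) +
    2 * D%:R * ln 4 * (\sum_(i < n) 2^-1 ^+ i.+1 * i.+1%:R).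
  by rewrite !mulr_sumr -big_split /=; apply: eq_bigr => i _; ring.
have ln4 : 0 <= ln 4 :> R by apply: ln_ge0; rewrite ler1n.
have ln4q : 0 <= ln (4 * q%:R) :> R by apply: ln_ge0; rewrite -natrM ler1n muln_gt0.
have -> : ln (64 * q%:R) = ln (4 * q%:R) + ln 4 * 2 :> R.
  have -> : ln 4 * 2 = ln 16 :> R.
    have -> : 16 = 4 ^+ 2 :> R by rewrite -natrX.
    by rewrite lnXn// mulr_natr.
  rewrite -lnM ?posrE ?mulr_gt0//; congr ln; ring.
have h1 := sum_half_le1 R n; have h2 := sum_half_linear_le2 R n.
have D0 : 0 <= D%:R :> R by [].
have c1 : 0 <= 2 * D%:R * ln (4 * q%:R) + 1 / 2 :> R by rewrite addr_ge0 ?mulr_ge0 ?divr_ge0.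
have c2 : 0 <= 2 * D%:R * ln 4 :> R by rewrite ?mulr_ge0.
have := ler_wpM2l c1 h1; have := ler_wpM2l c2 h2; lra.
Qed.

Section UniformDeviation.
Import mathcomp.boot.fintype mathcomp.boot.finset.
Variables (R : realType) (T G : finType) (p : T -> R) (phi : G -> T -> bool).
Variables (D q m : nat).
Hypothesis q_gt0 : (0 < q)%N.
Hypothesis p_ge0 : forall t, 0 <= p t.
Hypothesis p_sum1 : \sum_t p t = 1.
(** Restricted to points of positive mass: in the application these are patterns of actual bags, to
    which Radon's bound applies. *)
Hypothesis growth : forall k (t : {ffun 'I_k -> T}) (x : R),
  (forall j, 0 < p (t j)) -> 0 < x -> x <= 1 ->
  #|[set trace phi t g | g : G]|%:R * x ^+ D <= expR (x * (k * q)%:R).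

Let logN : R := 2 * D%:R * ln (64 * q%:R) + 1 / 2.

Let vals (g : G) (x : {ffun 'I_m -> T}) i : R := (phi g (x i))%:R.

Let signed_gap (x x' : {ffun 'I_m -> T}) (g : G) (s : {ffun 'I_m -> bool}) : R :=
  \sum_i (-1) ^+ s i * (vals g x' i - vals g x i).

(** For a fixed pair of samples this is a Rademacher process indexed by [G], chained in the Hamming
    distance on the [2 m] bags; hence [4 * lam ^+ 2 * (2 m)] in the exponent. *)
Lemma signed_gap_mgf (x x' : {ffun 'I_m -> T}) (lam : R) :
  (forall i, 0 < p (x i)) -> (forall i, 0 < p (x' i)) ->
  \sum_s \big[Num.max/0]_g expR (lam * signed_gap x x' g s) <=
  2 ^+ m * expR (8 * lam ^+ 2 * m%:R + logN).
Proof.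
move=> px px'.
pose y (i : 'I_m + 'I_m) := match i with inl i => x i | inr i => x' i end.
pose b g i := phi g (y i).
have cardI : #|{: 'I_m + 'I_m}| = (m + m)%N by rewrite card_sum card_ord.
have hamE g h : (hamming b g h)%:R = \sum_(i < m)
    ((phi g (x i) != phi h (x i))%:R + (phi g (x' i) != phi h (x' i))%:R) :> R.
  rewrite /hamming -sum1_card natr_sum big_mkcond big_split /= big_sumType /=.
  by congr (_ + _); apply: eq_bigr => i _; rewrite inE /b /=; case: eqP.
have cardOm : #|{ffun 'I_m -> bool}|%:R = 2 ^+ m :> R.
  by rewrite card_ffun card_bool card_ord natrX.
rewrite -cardOm.
apply: le_trans (@chaining R _ G (signed_gap x x') (hamming b) (m + m) (m + m)
  (fun j => 2 * D%:R * ln (4 * q%:R / (4 ^+ j.+1)^-1) + 1 / 2) lam _ _ _ _ _ _ _) _.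
- exact: hammingxx.
- exact: hamming_sym.
- move=> g h /hamming_eq0 e s; apply: eq_bigr => i _.
  by have := e (inl i); have := e (inr i); rewrite /b /vals /= => -> ->.
- move=> t g; under eq_bigr do rewrite mulr_sumr; rewrite cardOm.
  under eq_bigr do under eq_bigr do rewrite mulrCA.
  apply: le_trans (rademacher_mgf _) _; rewrite ler_wpM2l ?exprn_ge0// ler_expR.
  have : \sum_i (t * (vals g x' i - vals g x i)) ^+ 2 <= t ^+ 2 * m%:R.
    rewrite -[m in X in _ <= X]card_ord -sum1_card natr_sum mulr_sumr; apply: ler_sum => i _.
    rewrite exprMn ler_wpM2l ?sqr_ge0// /vals.
    by case: (phi g _); case: (phi g _); rewrite ?subrr ?subr0 ?sub0r ?sqrrN ?expr0n ?expr1n /=.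
  by rewrite natrD; have := sqr_ge0 t; have : 0 <= m%:R :> R by []; nra.
- move=> t g h; under eq_bigr do rewrite -sumrB mulr_sumr; rewrite cardOm.
  under eq_bigr do under eq_bigr do rewrite -mulrBr mulrCA.
  apply: le_trans (rademacher_mgf _) _; rewrite ler_wpM2l ?exprn_ge0// ler_expR.
  (* A squared increment at [i] is at most twice the number of disagreements there, and the factor 2
     cancels against the half in [rademacher_mgf]. *)
  rewrite ler_pdivrMr// -mulrA [_ * 2]mulrC hamE !mulr_sumr; apply: ler_sum => i _.
  rewrite exprMn ler_wpM2l ?sqr_ge0// /vals.
  case: (phi g (x i)); case: (phi g (x' i)); case: (phi h (x i)); case: (phi h (x' i)) => /=; lra.
- move=> j A sep.
  apply: (@packing_bound R G _ b D q q_gt0 _ A (4 ^+ j.+1)^-1).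
  + move=> k s z z0 z1.
    have -> : [set trace b s g | g : G] = [set trace phi [ffun j => y (s j)] g | g : G].
      by apply: eq_imset => g; apply/ffunP => i; rewrite !ffunE.
    by apply: growth => // i; rewrite ffunE; case: (s i).
  + by rewrite invr_gt0 exprn_gt0.
  + by rewrite invf_le1 ?exprn_gt0// exprn_ege1// ler1n.
  + by move=> g h gA hA ne; have := sep g h gA hA ne; rewrite cardI mulrC.
- by rewrite expnS (leq_trans (ltn_expl (m + m) (isT : (1 < 4)%N)))// leq_pmull.
rewrite ler_wpM2l// ler_expR lerD ?log_covering_sum_le//.
by rewrite natrD; lra.
Qed.

Let weight (x : {ffun 'I_m -> T}) : R := \prod_i p (x i).
Let mean (g : G) : R := \sum_t p t * (phi g t)%:R.

Lemma weight_ge0 x : 0 <= weight x.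
Proof. by apply: prodr_ge0 => i _; apply: p_ge0. Qed.

Lemma sum_weight : \sum_x weight x = 1.
Proof.
rewrite -(bigA_distr_bigA (fun _ t => p t)) /=.
by rewrite big1.
Qed.

Lemma sum_weight_vals g : \sum_x weight x * \sum_i vals g x i = m%:R * mean g.
Proof.
under eq_bigr do rewrite mulr_sumr.
rewrite exchange_big /= -[m in RHS]card_ord -sum1_card natr_sum mulr_suml.
apply: eq_bigr => i _; rewrite mul1r.
pose F k t := p t * (if k == i then (phi g t)%:R else 1).
transitivity (\sum_(x : {ffun 'I_m -> T}) \prod_k F k (x k)).
  apply: eq_bigr => x _; rewrite /F big_split /=; congr (_ * _).
  by rewrite -big_mkcond /= big_pred1_eq.
rewrite -bigA_distr_bigA /= (bigD1 i)//= [X in _ * X]big1 ?mulr1.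
  by apply: eq_bigr => t _; rewrite /F eqxx.
move=> k /negbTE ki; rewrite -[RHS]p_sum1.
by apply: eq_bigr => t _; rewrite /F ki mulr1.
Qed.

Let swap (s : {ffun 'I_m -> bool}) (z : {ffun 'I_m -> T} * {ffun 'I_m -> T}) :=
  ([ffun i => if s i then z.2 i else z.1 i], [ffun i => if s i then z.1 i else z.2 i]).

Lemma swapK s : involutive (swap s).
Proof.
by move=> [x x']; congr (_, _); apply/ffunP => i; rewrite !ffunE /=; case: (s i).
Qed.

Lemma weight_swap s z : weight (swap s z).1 * weight (swap s z).2 = weight z.1 * weight z.2.
Proof.
rewrite /weight -!big_split /=; apply: eq_bigr => i _; rewrite !ffunE.
by case: (s i) => //; rewrite mulrC.
Qed.

(** Exchanging [x i] and [x' i] preserves the product weight and flips the sign of the [i]-th gap,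
    so averaging over all [2 ^ m] swaps leaves a Rademacher process for each fixed pair. *)
Lemma symmetrized_mgf (lam : R) :
  \sum_z weight z.1 * weight z.2 *
    \big[Num.max/0]_g expR (lam * \sum_i (vals g z.2 i - vals g z.1 i)) <=
  expR (8 * lam ^+ 2 * m%:R + logN).
Proof.
set E := \sum_z _; pose K : R := 2 ^+ m.
have K0 : 0 < K by rewrite exprn_gt0.
rewrite -(ler_pM2l K0).
have -> : K * E = \sum_(s : {ffun 'I_m -> bool}) \sum_z weight z.1 * weight z.2 *
    \big[Num.max/0]_g expR (lam * signed_gap z.1 z.2 g s).
  transitivity (\sum_(s : {ffun 'I_m -> bool}) E).
    by rewrite sumr_const card_ffun card_bool card_ord /K -natrX mulr_natl.
  apply: eq_bigr => s _; rewrite /E (reindex_inj (inv_inj (@swapK s))) /=.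
  apply: eq_bigr => z _; rewrite weight_swap; congr (_ * _).
  apply: eq_bigr => g _; congr (expR (_ * _)); apply: eq_bigr => i _.
  rewrite /vals !ffunE; case: (s i); rewrite ?expr1 ?expr0 ?mul1r//.
  by rewrite mulN1r opprB.
rewrite exchange_big /=.
apply: (@le_trans _ _ (\sum_(z : {ffun 'I_m -> T} * {ffun 'I_m -> T})
    weight z.1 * weight z.2 * (K * expR (8 * lam ^+ 2 * m%:R + logN)))).
  apply: ler_sum => -[x x'] _ /=; rewrite -mulr_sumr.
  (* Pairs of weight 0 drop out; in the others every coordinate has positive mass, as
     [signed_gap_mgf] requires. *)
  have pos (w : {ffun 'I_m -> T}) : 0 < weight w -> forall i, 0 < p (w i).
    move=> w0 i; rewrite lt0r p_ge0 andbT; apply: contraTneq w0 => wi.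
    by rewrite /weight (bigD1 i)//= wi mul0r ltxx.
  have [x0|x0] := ltP 0 (weight x); last first.
    have -> : weight x = 0 by apply/eqP; rewrite eq_le x0 weight_ge0.
    by rewrite !mul0r.
  have [x'0|x'0] := ltP 0 (weight x'); last first.
    have -> : weight x' = 0 by apply/eqP; rewrite eq_le x'0 weight_ge0.
    by rewrite mulr0 !mul0r.
  by rewrite ler_pM2l ?mulr_gt0// signed_gap_mgf//; apply: pos.
rewrite -mulr_suml -(pair_bigA _ (fun x x' => weight x * weight x')) /=.
under eq_bigr do rewrite -mulr_sumr sum_weight mulr1.
by rewrite sum_weight mul1r.
Qed.

(** Markov's inequality for the exponential, with [m * mean g] written as the expectation of the sum
    over a ghost sample [x']; Jensen moves that expectation out of the exponential. *)
Lemma uniform_deviation_mgf (lam eps : R) : 0 <= lam ->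
  \sum_(x | [exists g, m%:R * eps < m%:R * mean g - \sum_i vals g x i]) weight x <=
  expR (8 * lam ^+ 2 * m%:R + logN - lam * (m%:R * eps)).
Proof.
move=> lam0; rewrite expRD expRN ler_pdivlMr ?expR_gt0//.
apply: le_trans (symmetrized_mgf lam).
rewrite -(pair_bigA _ (fun x x' => weight x * weight x' *
    \big[Num.max/0]_g expR (lam * \sum_i (vals g x' i - vals g x i)))) /=.
rewrite mulr_suml big_mkcond /=; apply: ler_sum => x _; case: ifPn => [/existsP[g gP]|_]; last first.
  apply: sumr_ge0 => x' _; rewrite mulr_ge0 ?mulr_ge0 ?weight_ge0//.
  exact: bigmax_ge_id.
under eq_bigr do rewrite -mulrA.
rewrite -mulr_sumr ler_wpM2l ?weight_ge0//.
apply: (@le_trans _ _ (\sum_x' weight x' * expR (lam * \sum_i (vals g x' i - vals g x i)))); last first.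
  apply: ler_sum => x' _; rewrite ler_wpM2l ?weight_ge0//.
  exact: (le_bigmax _ (fun g => expR (lam * \sum_i (vals g x' i - vals g x i))) g).
apply: (@le_trans _ _ (expR (\sum_x' weight x' * (lam * \sum_i (vals g x' i - vals g x i))))).
  rewrite ler_expR.
  have -> : \sum_x' weight x' * (lam * \sum_i (vals g x' i - vals g x i)) =
      lam * (m%:R * mean g - \sum_i vals g x i).
    under eq_bigr do rewrite sumrB mulrCA mulrBr.
    by rewrite -mulr_sumr sumrB sum_weight_vals -mulr_suml sum_weight mul1r.
  by rewrite ler_wpM2l// ltW.
apply: le_trans (expR_convex_comb _ _ _) _ => [x' _||]; rewrite ?weight_ge0 ?sum_weight//.
by rewrite subrr addr0.
Qed.
End UniformDeviation.

(** * Finite families of halfspaces *)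

Lemma finite_image_eq (Om : Type) (Z : finType) (tau : Om -> Z) (Q : pred Z) :
  [set w | Q (tau w)] = \bigcup_(z in [set` enum Q]) [set w | tau w = z].
Proof.
apply/seteqP; split=> [w /= Qw|w [z /= zQ wz]]; last by move: zQ; rewrite mem_enum wz.
by exists (tau w) => //=; rewrite mem_enum.
Qed.

Lemma measurable_finite_image (dO : measure_display) (Om : measurableType dO)
    (Z : finType) (tau : Om -> Z) (Q : pred Z) :
  (forall z, measurable [set w | tau w = z]) -> measurable [set w | Q (tau w)].
Proof.
move=> mtau; rewrite finite_image_eq.
by apply: fin_bigcup_measurable => //; exact: finite_finset.
Qed.

Lemma measure_finite_image (R : realType) (dO : measure_display) (Om : measurableType dO)
    (P : probability Om R) (Z : finType) (tau : Om -> Z) (W : Z -> R) (Q : pred Z) :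
  (forall z, measurable [set w | tau w = z]) ->
  (forall z, P [set w | tau w = z] = (W z)%:E) ->
  P [set w | Q (tau w)] = (\sum_(z | Q z) W z)%:E.
Proof.
move=> mtau Ptau; rewrite finite_image_eq.
rewrite measure_fin_bigcup; [|exact: finite_finset| |by []]; last first.
  by move=> z z' _ _ [w [/= <- <-]].
rewrite -fsbig_seq ?enum_uniq// big_enum /= -sumEFin.
by apply: eq_bigr => z _; rewrite Ptau.
Qed.

Lemma measurable_level_set_ltf (R : realType) (d : nat) (r : d.-tuple R) (c : R) b :
  measurable (level_set (ltf r c) b).
Proof.
have mf : measurable_fun setT (fun x : d.-tuple R => ltf r c x).
  apply: measurable_fun_ltr; first exact: measurable_cst.
  apply: measurable_funD; last exact: measurable_cst.
  apply: measurable_sum => i; apply: measurable_funM; first exact: measurable_cst.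
  exact: measurable_tnth.
by rewrite -[level_set _ _]setTI; apply: (mf measurableT [set b]).
Qed.

Lemma measurable_bag_err (R : realType) (d q k : nat) (dY : measure_display)
    (OmY : measurableType dY) (Y : 'I_q -> OmY -> d.-tuple R) (r : d.-tuple R) (c : R) :
  (forall j, measurable_fun setT (Y j)) ->
  measurable [set w | bag_avg (ltf r c) (fun j => Y j w) != k%:R / q%:R].
Proof.
move=> mY.
pose tau w : {ffun 'I_q -> bool} := [ffun j => ltf r c (Y j w)].
pose Q (t : {ffun 'I_q -> bool}) := (\sum_j (t j : nat)%:R) / q%:R != k%:R / q%:R :> R.
have -> : [set w | bag_avg (ltf r c) (fun j => Y j w) != k%:R / q%:R] = [set w | Q (tau w)].
  have QE w : Q (tau w) = (bag_avg (ltf r c) (fun j => Y j w) != k%:R / q%:R).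
    by congr (_ / _ != _); apply: eq_bigr => j _; rewrite ffunE.
  by apply/seteqP; split=> w /=; rewrite QE.
apply: measurable_finite_image => z.
have -> : [set w | tau w = z] =
    \bigcap_(j in [set: 'I_q]) (setT `&` Y j @^-1` level_set (ltf r c) (z j)).
  apply/seteqP; split=> [w /= <- j _|w h]; first by rewrite /level_set /= ffunE.
  by apply/ffunP => j; rewrite ffunE; have [] := h j I.
apply: fin_bigcap_measurable; first exact: finite_finset.
by move=> j _; apply: mY => //; apply: measurable_level_set_ltf.
Qed.

Section Patterns.
Variables (R : realType) (d q k N : nat) (r : 'I_N -> d.-tuple R) (c : 'I_N -> R).

(** This encodes the cell of [x] in the arrangement of the [N] halfspaces. *)
Definition pattern (x : d.-tuple R) : {ffun 'I_N -> bool} := [ffun g => ltf (r g) (c g) x].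

Definition bag_pattern (B : 'I_q -> d.-tuple R) : {ffun 'I_q -> {ffun 'I_N -> bool}} :=
  [ffun j => pattern (B j)].

Definition pattern_err (g : 'I_N) (t : {ffun 'I_q -> {ffun 'I_N -> bool}}) : bool :=
  (\sum_(j < q) (t j g : nat)%:R) / q%:R != k%:R / q%:R :> R.

Lemma bag_patternE g (B : 'I_q -> d.-tuple R) :
  (bag_avg (ltf (r g) (c g)) B != k%:R / q%:R) = pattern_err g (bag_pattern B).
Proof.
rewrite /pattern_err /bag_avg; congr (_ / _ != _).
by apply: eq_bigr => j _; rewrite !ffunE.
Qed.

Lemma measurable_pattern u : measurable [set x | pattern x = u].
Proof.
have -> : [set x | pattern x = u] =
    \bigcap_(g in [set: 'I_N]) level_set (ltf (r g) (c g)) (u g).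
  apply/seteqP; split=> [x /= <- g _|x xu]; first by rewrite /level_set /= ffunE.
  by apply/ffunP => g; rewrite ffunE; apply: xu.
apply: fin_bigcap_measurable; first exact: finite_finset.
by move=> g _; apply: measurable_level_set_ltf.
Qed.

(** The errors on the [n] bags depend on [g] only through the set of those of the [n * q] points
    that it labels 1, and these sets have VC dimension at most [d + 1]. [Phi] recovers the errors
    from such a set. *)
Lemma card_pattern_trace (n : nat) (t : {ffun 'I_n -> {ffun 'I_q -> {ffun 'I_N -> bool}}})
    (B : 'I_n -> 'I_q -> d.-tuple R) (x : R) :
  (forall i, t i = bag_pattern (B i)) -> 0 < x -> x <= 1 ->
  #|[set trace pattern_err t g | g : 'I_N]%SET|%:R * x ^+ d.+1 <=
  expR (x * (n * q)%:R).
Proof.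
move=> tB x0 x1.
pose S (g : 'I_N) := [set ij : 'I_n * 'I_q | ltf (r g) (c g) (B ij.1 ij.2)]%SET.
pose F := [set S g | g : 'I_N]%SET.
pose Phi (s : {set 'I_n * 'I_q}) : {ffun 'I_n -> bool} := [ffun i =>
  (\sum_(j < q) (((i, j) \in s) : nat)%:R) / q%:R != k%:R / q%:R :> R].
have -> : [set trace pattern_err t g | g : 'I_N]%SET = [set Phi s | s in F]%SET.
  rewrite -imset_comp; apply: eq_imset => g; apply/ffunP => i.
  rewrite !ffunE tB /pattern_err; congr (_ / _ != _).
  by apply: eq_bigr => j _; rewrite !ffunE inE.
apply: (@le_trans _ _ (#|F|%:R * x ^+ d.+1)).
  by rewrite ler_wpM2r ?exprn_ge0 ?(ltW x0)// ler_nat leq_imset_card.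
have := @card_vc_le ('I_n * 'I_q)%type R F d.+1 x x0 x1 (fun s => @shatters_ltf _ _ _ _ _ r c s).
by rewrite card_prod !card_ord.
Qed.
End Patterns.

(** The value [lam = eps / 16] minimises [8 lam^2 m - lam m eps], giving [- m eps^2 / 32]. As
    [d >= 1] and [q >= 2], the entropy term is at most [29 d ln q], and [1000 / 32] exceeds 29. *)
Lemma sample_size_suffices (R : realType) (d q m : nat) (delta eps : R) :
  (0 < d)%N -> (2 <= q)%N -> 0 < delta -> delta < 1 -> 0 < eps ->
  1000 * d%:R * (ln q%:R + ln (1 / delta)) / eps ^+ 2 <= m%:R ->
  (0 < m)%N /\
  expR (8 * (eps / 16) ^+ 2 * m%:R + (2 * d.+1%:R * ln (64 * q%:R) + 1 / 2)
        - eps / 16 * (m%:R * eps)) <= delta.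
Proof.
move=> d0 q2 delta0 delta1 eps0.
have d1 : 1 <= d%:R :> R by rewrite ler1n.
have q0 : 0 < q%:R :> R by rewrite ltr0n (ltn_trans _ q2).
have ln2 : 1 / 2 <= ln 2 :> R.
  have := @expR_ge1Dx R (- ln 2); rewrite expRN lnK ?posrE//; lra.
have lnq : ln 2 <= ln q%:R :> R by rewrite ler_ln ?posrE// ler_nat.
have lnd : 0 < - ln delta by rewrite oppr_gt0 ln_lt0// delta0.
rewrite div1r lnV ?posrE//; set l := ln q%:R in lnq *; set e := - ln delta in lnd *.
rewrite ler_pdivrMr ?exprn_gt0// => hm.
have hm1 : 1000 * d%:R * l + 1000 * e <= m%:R * eps ^+ 2.
  apply: le_trans hm; have : e <= d%:R * e by rewrite ler_peMl// ltW.
  lra.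
split.
  rewrite -(ltr0n R) ltNge; apply/negP => m0.
  have m0' : m%:R = 0 :> R by apply/eqP; rewrite eq_le m0 ler0n.
  by move: hm1; rewrite m0' mul0r; nra.
rewrite -[leRHS]lnK ?posrE// ler_expR.
have ln64 : ln (64 * q%:R) <= 7 * l.
  rewrite lnM ?posrE// (_ : 64 = 2 ^+ 6); last by rewrite -natrX.
  by rewrite lnXn// -[ln 2 *+ 6]mulr_natl -/l; lra.
have : d.+1%:R * ln (64 * q%:R) <= 2 * d%:R * (7 * l).
  apply: (@le_trans _ _ (d.+1%:R * (7 * l))); first by rewrite ler_wpM2l.
  by rewrite ler_wpM2r ?mulr_ge0//; [lra|rewrite -[d.+1%:R]natr1; lra].
have : 1 / 2 <= d%:R * l by nra.
have : 8 * (eps / 16) ^+ 2 * m%:R - eps / 16 * (m%:R * eps) = - (m%:R * eps ^+ 2) / 32.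
  by field.
have -> : ln delta = - e by rewrite opprK.
lra.
Qed.

Section FiniteFamily.
Variables (R : realType) (d q k : nat) (D : probability (d.-tuple R) R).
Variables (f : d.-tuple R -> bool).
Variables (dY : measure_display) (OmY : measurableType dY)
  (PY : probability OmY R) (Y : 'I_q -> OmY -> d.-tuple R).
Hypothesis lawY : has_bag_law k D f PY Y.
Variables (m : nat) (dO : measure_display) (Om : measurableType dO)
  (P : probability Om R) (X : 'I_m -> 'I_q -> Om -> d.-tuple R).
Hypothesis lawX : iid_bags k D f P X.
Variable (eps : R).

Definition good_event (r : d.-tuple R) (c : R) : set Om := [set w |
  (bag_err_oracle k PY Y (ltf r c) <=
   (bag_err_sample k (ltf r c) (fun i j => X i j w) + eps)%:E)%E].

(** After passing to cells, the sample is [m] independent draws from the finite law [p] and the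
    oracle error is a mean under [p], so [uniform_deviation_mgf] applies with [lam = eps / 16]. *)
Lemma finite_family_good_event (N : nat) (r : 'I_N -> d.-tuple R) (c : 'I_N -> R)
    (delta : R) :
  (0 < q)%N -> (0 < m)%N -> 0 < eps ->
  expR (8 * (eps / 16) ^+ 2 * m%:R + (2 * d.+1%:R * ln (64 * q%:R) + 1 / 2)
        - eps / 16 * (m%:R * eps)) <= delta ->
  measurable [set w | forall g, good_event (r g) (c g) w] /\
  ((1 - delta)%:E <= P [set w | forall g, good_event (r g) (c g) w])%E.
Proof.
move=> q0 m0 eps0 hdelta.
pose T := {ffun 'I_q -> {ffun 'I_N -> bool}}.
pose p (t : T) : R := \prod_(j < q) cond_prob D (level_set f (bag_label k j)) [set x | pattern r c x = t j].
pose phi := @pattern_err R q k N.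
have [mY PY_law] := lawY; have [mX PX_law] := lawX.
pose tauY w : T := bag_pattern r c (fun j => Y j w).
pose tauX w : {ffun 'I_m -> T} := [ffun i => bag_pattern r c (fun j => X i j w)].
have tauYE t : [set w | tauY w = t] = [set w | forall j, [set x | pattern r c x = t j] (Y j w)].
  apply/seteqP; split=> [w /= <- j|w /= h]; first by rewrite ffunE.
  by apply/ffunP => j; rewrite ffunE.
have tauXE x : [set w | tauX w = x] =
    [set w | forall i j, [set z | pattern r c z = x i j] (X i j w)].
  apply/seteqP; split=> [w /= <- i j|w /= h]; first by rewrite !ffunE.
  by apply/ffunP => i; apply/ffunP => j; rewrite !ffunE.
have mtauY t : measurable [set w | tauY w = t].
  rewrite tauYE; have -> : [set w | forall j, [set x | pattern r c x = t j] (Y j w)] =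
      \bigcap_(j in [set: 'I_q]) (setT `&` Y j @^-1` [set x | pattern r c x = t j]).
    by apply/seteqP; split=> [w h j _|w h j]; [split=> //; exact: h|have [] := h j I].
  apply: fin_bigcap_measurable; first exact: finite_finset.
  by move=> j _; apply: mY => //; apply: measurable_pattern.
have mtauX x : measurable [set w | tauX w = x].
  rewrite tauXE; have -> : [set w | forall i j, [set z | pattern r c z = x i j] (X i j w)] =
      \bigcap_(ij in [set: 'I_m * 'I_q])
        (setT `&` X ij.1 ij.2 @^-1` [set z | pattern r c z = x ij.1 ij.2]).
    apply/seteqP; split=> [w h [i j] _|w h i j]; [split=> //; exact: h|by have [] := h (i, j) I].
  apply: fin_bigcap_measurable; first exact: finite_finset.
  by move=> ij _; apply: mX => //; apply: measurable_pattern.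
have PtauY t : PY [set w | tauY w = t] = (p t)%:E.
  rewrite tauYE; apply: (PY_law (fun j => [set x | pattern r c x = t j])) => j.
  exact: measurable_pattern.
have PtauX x : P [set w | tauX w = x] = (\prod_i p (x i))%:E.
  rewrite tauXE; apply: (PX_law (fun i j => [set z | pattern r c z = x i j])) => i j.
  exact: measurable_pattern.
have p_ge0 t : 0 <= p t by rewrite -lee_fin -PtauY measure_ge0.
have p_sum1 : \sum_t p t = 1.
  have := measure_finite_image xpredT mtauY PtauY.
  rewrite (_ : [set w | _] = setT) ?probability_setT; first by case.
  by apply/seteqP; split.
have growth n (t : {ffun 'I_n -> T}) (x : R) : (forall j, 0 < p (t j)) -> 0 < x -> x <= 1 ->
    #|[set trace phi t g | g : 'I_N]%SET|%:R * x ^+ d.+1 <= expR (x * (n * q)%:R).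
  move=> pt x0 x1.
  (* A pattern of positive probability is attained at some outcome, which supplies actual points of
     R^d. *)
  have /choice[w wP] : forall i, exists w, tauY w = t i.
    move=> i; apply: contrapT => /forallNP no; have := pt i.
    rewrite -lte_fin -PtauY (_ : [set w | _] = set0) ?measure0 ?ltxx//.
    by apply/seteqP; split=> w //= /no.
  by apply: (@card_pattern_trace R d q k N r c n t (fun i j => Y j (w i))) => // i; rewrite -wP.
pose mean g := \sum_t p t * (phi g t)%:R.
have oracleE g : bag_err_oracle k PY Y (ltf (r g) (c g)) = (mean g)%:E.
  have := measure_finite_image (phi g) mtauY PtauY.
  rewrite /bag_err_oracle (_ : [set w | phi g (tauY w)] =
    [set w | bag_avg (ltf (r g) (c g)) (fun j => Y j w) != k%:R / q%:R]); last first.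
    by apply/seteqP; split=> w /=; rewrite bag_patternE.
  move=> ->; rewrite big_mkcond /=; congr EFin; apply: eq_bigr => t _.
  by case: (phi g t); rewrite ?mulr1 ?mulr0.
have sampleE g w : bag_err_sample k (ltf (r g) (c g)) (fun i j => X i j w) =
    (\sum_i (phi g (tauX w i))%:R) / m%:R.
  rewrite /bag_err_sample; congr (_ / _); rewrite -sum1_card natr_sum big_mkcond /=.
  apply: eq_bigr => i _; rewrite ffunE /phi -bag_patternE.
  case: ifPn => [|/negP]; rewrite in_setE /=; first by move=> ->.
  by move=> /negP/negbTE ->.
pose bad (x : {ffun 'I_m -> T}) :=
  [exists g, m%:R * eps < m%:R * mean g - \sum_i (phi g (x i))%:R :> R].
have devE (a b : R) : (m%:R * a - b <= m%:R * eps) = (a <= b / m%:R + eps).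
  rewrite lerBlDr addrC -lerBlDr -mulrBr [m%:R * _]mulrC -ler_pdivlMr ?ltr0n//.
  by rewrite lerBlDr.
have goodE : [set w | forall g, good_event (r g) (c g) w] = [set w | predC bad (tauX w)].
  apply/seteqP; split=> w /=.
    move=> h; apply/existsPn => g; have := h g; rewrite /good_event /= oracleE sampleE lee_fin.
    by rewrite -leNgt devE.
  move=> /existsPn h g; have := h g; rewrite /good_event /= oracleE sampleE lee_fin.
  by rewrite -leNgt devE.
rewrite goodE; split; first exact: measurable_finite_image.
rewrite (measure_finite_image _ mtauX PtauX) lee_fin.
have tot : \sum_x \prod_i p ((x : {ffun 'I_m -> T}) i) = 1 by exact: sum_weight.
have lam0 : 0 <= eps / 16 by rewrite divr_ge0// ltW.
have := le_trans
  (@uniform_deviation_mgf R T 'I_N p phi d.+1 q m q0 p_ge0 p_sum1 growth _ eps lam0) hdelta.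
by rewrite -/bad; move: tot; rewrite (bigID bad) /=; lra.
Qed.
End FiniteFamily.

(** * All halfspaces *)

Lemma eventually_finite (I : finType) (Q : I -> nat -> Prop) :
  (forall i, exists n0, forall n, (n0 <= n)%N -> Q i n) ->
  exists n0, forall n, (n0 <= n)%N -> forall i, Q i n.
Proof.
move=> /choice[n0 n0P]; exists (\max_i n0 i)%N => n le i.
by apply: n0P; apply: leq_trans le; apply: leq_bigmax.
Qed.

Definition ratr_tuple (R : realType) (d : nat) (t : d.-tuple rat) : d.-tuple R :=
  [tuple of map ratr t].

(* Approximating c strictly from below, at a slower rate than r, preserves the
   points lying exactly on the boundary hyperplane. *)
Lemma ltf_rational_approx (R : realType) (d : nat) (r : d.-tuple R) (c : R) :
  exists (a : nat -> d.-tuple rat) (b : nat -> rat),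
  forall x, exists n0, forall n, (n0 <= n)%N ->
    ltf (ratr_tuple R (a n)) (ratr (b n)) x = ltf r c x.
Proof.
pose u n : R := n.+1%:R^-1.
have u0 n : 0 < u n by rewrite invr_gt0.
have u1 n : u n <= 1 by rewrite invf_le1// ler1n.
have /choice[b bP] : forall n, exists b, ratr b \in `]c - 2 * u n, c - u n[.
  by move=> n; apply: rat_in_itvoo; have := u0 n; lra.
have /choice[a' aP] : forall ni : nat * 'I_d, exists a,
    ratr a \in `]tnth r ni.2 - u ni.1 ^+ 2, tnth r ni.2 + u ni.1 ^+ 2[.
  move=> [n i] /=; apply: rat_in_itvoo.
  by have : 0 < u n ^+ 2 by [rewrite exprn_gt0]; lra.
exists (fun n => [tuple a' (n, i) | i < d]), b => x.
pose B := \sum_i `|tnth x i|.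
have B0 : 0 <= B by apply: sumr_ge0.
pose v := \sum_(i < d) tnth r i * tnth x i + c.
(* The summand [B] ensures [B * u n <= 1], so for [v <= 0] the error [B * u n ^+ 2] is outweighed by
   the lowering of [c]; the quotient ensures [(B + 2) * u n < v] for [v > 0]. At [v = 0] the
   quotient is 0 by convention. *)
exists (Num.truncn (B + (B + 2) / `|v|)) => n len.
have nB : B + (B + 2) / `|v| < n.+1%:R.
  by apply: lt_le_trans (truncnS_gt _) _; rewrite ler_nat.
have vB0 : 0 <= (B + 2) / `|v| by rewrite divr_ge0// addr_ge0.
have nu : n.+1%:R * u n = 1 by rewrite divff.
have uB : B * u n <= 1 by rewrite -nu ler_wpM2r ?(ltW (u0 n))//; lra.
pose e := \sum_(i < d) (ratr (a' (n, i)) - tnth r i) * tnth x i.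
have eB : `|e| <= B * u n ^+ 2.
  apply: le_trans (ler_norm_sum _ _ _) _; rewrite mulr_suml; apply: ler_sum => i _.
  rewrite normrM mulrC ler_wpM2l// ler_norml.
  by have := aP (n, i); rewrite in_itv /= => /andP[? ?]; lra.
have [e1 e2] : - (B * u n ^+ 2) <= e /\ e <= B * u n ^+ 2 by apply/andP; rewrite -ler_norml.
have := bP n; rewrite in_itv /= => /andP[b1 b2].
rewrite /ltf /pos -/v.
have -> : \sum_(i < d) tnth (ratr_tuple R [tuple a' (n, i) | i < d]) i * tnth x i + ratr (b n) =
    v + e + (ratr (b n) - c).
  have -> : \sum_(i < d) tnth (ratr_tuple R [tuple a' (n, i) | i < d]) i * tnth x i =
      \sum_(i < d) tnth r i * tnth x i + e.
    rewrite -big_split /=; apply: eq_bigr => i _.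
    by rewrite tnth_map tnth_mktuple; ring.
  by rewrite /v; ring.
have uu : u n ^+ 2 = u n * u n by rewrite expr2.
have := u0 n; have := u1 n => un1 un0.
have [v0|v0] := ltP 0 v.
  have h : (B + 2) * u n < v.
    have : B + 2 < n.+1%:R * v.
      by rewrite -ltr_pdivrMr//; move: nB vB0; rewrite gtr0_norm//; lra.
    by rewrite -(ltr_pM2r (u0 n)) mulrAC nu mul1r.
  have : B * u n ^+ 2 <= B * u n by rewrite uu ler_wpM2l// ler_piMr// ltW.
  lra.
apply/negbTE; rewrite -leNgt.
have : B * u n ^+ 2 <= u n by rewrite uu mulrA ler_piMl// ltW.
lra.
Qed.

(** Fatou's lemma for sets: [A] lies in the union of the increasing intersections [F n], and each
    [F n] is contained in [An n]. *)
Lemma measure_liminf_le (R : realType) (dO : measure_display) (Om : measurableType dO)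
    (P : probability Om R) (A : set Om) (An : nat -> set Om) (n0 : nat) (b : \bar R) :
  measurable A -> (forall n, measurable (An n)) ->
  (forall w, A w -> exists n1, forall n, (n1 <= n)%N -> An n w) ->
  (forall n, (n0 <= n)%N -> P (An n) <= b)%E -> (P A <= b)%E.
Proof.
move=> mA mAn sub le.
pose F n := \bigcap_(j in [set j | (n <= j)%N]) An j.
have mF n : measurable (F n).
  by apply: bigcap_measurableType.
have mU : measurable (\bigcup_n F n) by apply: bigcup_measurable.
apply: (@le_trans _ _ (P (\bigcup_n F n))).
  apply: le_measure; rewrite ?inE// => w /sub[n1 h].
  by exists n1 => // j /= /h.
have cv : (P \o F) x @[x --> \oo] --> P (\bigcup_n F n).
  apply: nondecreasing_cvg_mu => // n n' nn'; apply/subsetPset => w h j /= n'j.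
  by apply: h => /=; apply: leq_trans n'j.
rewrite -(cvg_lim _ cv)//; apply: lime_le; first by apply/cvg_ex; eexists; exact: cv.
exists n0 => // n /= n0n; apply: le_trans (le n n0n).
by apply: le_measure; rewrite ?inE// => w h; apply: h => /=.
Qed.

Theorem theorem8 (R : realType) :
  exists C0 : R, C0 <= 1000 /\
  forall (d q k : nat) (D : probability (d.-tuple R) R)
    (r0 : d.-tuple R) (c0 : R),
  (2 <= q)%N -> (1 <= k <= q - 1)%N ->
  (0 < D (level_set (ltf r0 c0) true))%E ->
  (0 < D (level_set (ltf r0 c0) false))%E ->
  forall (dY : measure_display) (OmY : measurableType dY)
    (PY : probability OmY R) (Y : 'I_q -> OmY -> d.-tuple R),
  has_bag_law k D (ltf r0 c0) PY Y ->
  forall (delta eps : R), 0 < delta -> 0 < eps ->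
  forall (m : nat) (dO : measure_display) (Om : measurableType dO)
    (P : probability Om R) (X : 'I_m -> 'I_q -> Om -> d.-tuple R),
  iid_bags k D (ltf r0 c0) P X ->
  C0 * d%:R * (ln q%:R + ln (1 / delta)) / eps ^+ 2 <= m%:R ->
  exists G : set Om, measurable G /\ (1 - delta <= fine (P G)) /\
    forall w, G w ->
    forall (r : d.-tuple R) (c : R),
      (bag_err_oracle k PY Y (ltf r c) <=
       (bag_err_sample k (ltf r c) (fun i j => X i j w) + eps)%:E)%E.
Proof.
exists 1000; split=> // d q k D r0 c0 q2 _ Dtrue Dfalse dY OmY PY Y lawY delta eps
  delta0 eps0 m dO Om P X lawX hm.
have [delta1|delta1] := leP 1 delta.
  exists set0; split; first exact: measurable0.
  by rewrite measure0 /= subr_le0.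
(* In dimension 0 the bound on [m] is void, but there the target is constant, so one of its level
   sets is empty, against the positivity hypotheses. *)
have d0 : (0 < d)%N.
  case: d D r0 Dtrue Dfalse {Y lawY X lawX hm} => // D r0 Dtrue Dfalse.
  have ltfE x : ltf r0 c0 x = pos c0 by rewrite /ltf big_ord0 add0r.
  have level0 : level_set (ltf r0 c0) (~~ pos c0) = set0.
    apply/seteqP; split=> x //=; rewrite /level_set /= ltfE.
    by case: pos.
  by move: level0 Dtrue Dfalse; case: pos => /= ->; rewrite measure0 ltxx.
have q0 : (0 < q)%N by rewrite (ltn_trans _ q2).
have [m0 hdelta] := sample_size_suffices d0 q2 delta0 delta1 eps0 hm.
(* An enumeration of the rational halfspaces; integers that code none get the target as a
   default. *)
pose par (n : nat) : d.-tuple R * R :=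
  if unpickle n is Some ab then
    let: (a, b) := ab : d.-tuple rat * rat in (ratr_tuple R a, ratr b)
  else (r0, c0).
pose good := good_event k PY Y X eps.
pose F (n : nat) : set Om := [set w | forall i : 'I_n, good (par i).1 (par i).2 w].
have F_good n : measurable (F n) /\ ((1 - delta)%:E <= P (F n))%E.
  exact: (finite_family_good_event lawY lawX (fun i : 'I_n => (par i).1) (fun i : 'I_n => (par i).2)).
have mG : measurable (\bigcap_n F n) by apply: bigcapT_measurable => n; have [] := F_good n.
exists (\bigcap_n F n); split => //; split.
  have cv : (P \o F) x @[x --> \oo] --> P (\bigcap_n F n).
    apply: nonincreasing_cvg_mu => //.
      by rewrite (le_lt_trans (probability_le1 _ _)) ?ltry//; have [] := F_good 0.
      by move=> n; have [] := F_good n.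
    move=> n n' nn'; apply/subsetPset => w h i.
    exact: (h (widen_ord nn' i)).
  rewrite -lee_fin fineK ?fin_num_measure// -(cvg_lim _ cv)//.
  apply: lime_ge; first by apply/cvg_ex; eexists; exact: cv.
  by apply: nearW => n; have [] := F_good n.
move=> w Gw r c.
have goodw n : good (par n).1 (par n).2 w by exact: (Gw n.+1 I ord_max).
have [a [b abP]] := ltf_rational_approx r c.
pose hn n := ltf (ratr_tuple R (a n)) (ratr (b n)).
have good_hn n : (bag_err_oracle k PY Y (hn n) <=
    (bag_err_sample k (hn n) (fun i j => X i j w) + eps)%:E)%E.
  by have := goodw (pickle (a n, b n)); rewrite /par pickleK.
(* The sample has only [m * q] points, so from some [n0] on [hn n] labels all of them as [ltf r c]
   does. *)
have [n0 n0P] := @eventually_finite ('I_m * 'I_q)%type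
  (fun ij n => hn n (X ij.1 ij.2 w) = ltf r c (X ij.1 ij.2 w)) (fun ij => abP _).
have sampleE n : (n0 <= n)%N -> bag_err_sample k (hn n) (fun i j => X i j w) =
    bag_err_sample k (ltf r c) (fun i j => X i j w).
  move=> /n0P e; rewrite /bag_err_sample; congr (_%:R / _); apply: eq_card => i.
  have avgE : bag_avg (hn n) (fun j => X i j w) = bag_avg (ltf r c) (fun j => X i j w).
    by congr (_ / _); apply: eq_bigr => j _; rewrite (e (i, j)).
  by apply/idP/idP; rewrite !in_setE /= avgE.
have [mY _] := lawY.
(* On the oracle side the rank from which the labels agree varies with the outcome, so the Fatou
   argument replaces equality. *)
apply: (@measure_liminf_le _ _ _ PY _
  (fun n => [set w | bag_avg (hn n) (fun j => Y j w) != k%:R / q%:R]) n0).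
- exact: measurable_bag_err.
- by move=> n; apply: measurable_bag_err.
- move=> w' /= ne; have [n1 n1P] := @eventually_finite 'I_q
    (fun j n => hn n (Y j w') = ltf r c (Y j w')) (fun j => abP _).
  exists n1 => n /n1P e; rewrite /bag_avg; under eq_bigr do rewrite e.
  exact: ne.
- by move=> n n0n; rewrite -(sampleE n n0n); apply: good_hn.
Qed.
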